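(* Let $d\ge 2$ and let $\alpha_1,\dots,\alpha_{d-1},\beta_1,\dots,\beta_d$ be real numbers. The $d\times d$ matrix $$\mathbf{B}=\begin{bmatrix} \beta_1 & 0 & \cdots & 0 & \alpha_1\\ 0 & \beta_2 & \cdots & 0 & \alpha_2\\ \vdots & \vdots & \ddots & \vdots & \vdots\\ 0 & 0 & \cdots & \beta_{d-1} & \alpha_{d-1}\\ \alpha_1 & \alpha_2 & \cdots & \alpha_{d-1} & \beta_d \end{bmatrix}$$ is in $\mathcal{B}_d$ if and only if $0\le \alpha_i\le \beta_i$ for $i=1,\dots,d-1$, $\sum_{i=1}^{d-1}\alpha_i\le \beta_d$, and $$\sum_{i=1}^{d}\beta_i-\sum_{i=1}^{d-1}\alpha_i\le 1.$$
   Context: $\mathcal{B}_d$ denotes the set of $d\times d$ Bernoulli Compatible Matrices (BCMs): the matrices that can be expressed as $\mathbb{E}(\mathbf{X}\mathbf{X}^{\mathsf T})$ for some random vector $\mathbf{X}$ taking values in $\{0,1\}^d$. *)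

(* Defs.v *)
From HB Require Import structures.
From mathcomp Require Import all_boot all_order all_algebra.
From mathcomp Require Import all_classical all_reals all_analysis.

Set Implicit Arguments.
Unset Strict Implicit.
Unset Printing Implicit Defensive.

Import Order.TTheory GRing.Theory Num.Theory.

Local Open Scope ring_scope.

Definition binary_col (R : realType) (d : nat) (x : d.-tuple bool) : 'cV[R]_d :=
  \col_(i < d) (tnth x i)%:R.

(* The expectation of the random matrix X X^T is taken entrywise. *)
Definition bernoulli_compatible (R : realType) (d : nat) (B : 'M[R]_d) : Prop :=
  exists (disp : measure_display) (T : measurableType disp)
         (P : probability T R) (X : {RV P >-> d.-tuple bool}),
    forall i j : 'I_d,
      ('E_P[fun w => (binary_col R (X w) *m (binary_col R (X w))^T) i j]
       = (B i j)%:E)%E.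

(* Here d = n + 1: the last row and column are alpha, except for the corner
   entry, which is the last entry of beta. *)
Definition arrow_mx (R : realType) (n : nat)
    (alpha : 'rV[R]_n) (beta : 'rV[R]_(n + 1)) : 'M[R]_(n + 1) :=
  block_mx (diag_mx (lsubmx beta)) alpha^T
           alpha                   (rsubmx beta).

(* Main.v *)
Require Import Defs.
From HB Require Import structures.
From mathcomp Require Import all_boot all_order all_algebra.
From mathcomp Require Import all_classical all_reals all_analysis.
From mathcomp Require Import measurable_realfun ring lra.

Set Implicit Arguments.
Unset Strict Implicit.
Unset Printing Implicit Defensive.

Import Order.TTheory GRing.Theory Num.Theory.

Local Open Scope ring_scope.

(** Only the law of the random vector matters, and that law lives on the finite
    set of binary tuples: compatibility of a matrix means that it is the second
    moment matrix of finitely many nonnegative weights [p] of total mass 1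
    ([bernoulli_compatibleP]). The statement thereby becomes one about finite
    sums.

    View the index set as a star: the first [n] coordinates are leaves, the last
    one is the hub. The zeros of the arrow matrix say that almost surely at most
    one leaf equals 1. Write S for the number of leaves equal to 1 and x for the
    hub. Then E[S] and E[S^2] agree, since the off-diagonal terms of S^2 have
    mean zero, so every linear inequality may be corrected by a multiple of
    S^2 - S for free. Two inequalities valid for all natural S and all x in
    {0, 1},
<<
      S x <= x + (S^2 - S)    and    S + x - S x <= 1 + (S^2 - S),
>>
    give on taking means exactly the two conditions on sums; the entrywise
    bounds are the means of 0 <= y x <= y for a leaf y. This is
    [arrow_necessary].

    Conversely, outside a null event the vector is determined by which leaf, if
    any, equals 1 and by the value of the hub. The matrix then fixes the weight
    of each such outcome: alpha_i for leaf i with the hub, beta_i - alpha_i for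
    leaf i alone, beta_d - sum alpha for the hub alone, and the complement to 1
    for the zero vector. The hypotheses say precisely that these weights are
    nonnegative ([arrow_sufficient]). *)

(** * Finite laws of binary vectors *)

Lemma measurable_tuple_bool1 (d : nat) (t : d.-tuple bool) :
  measurable [set t]%classic.
Proof.
have -> : [set t]%classic =
    (\bigcap_(i in [set: 'I_d])
       (fun x : d.-tuple bool => tnth x i) @^-1` [set tnth t i])%classic.
  apply/seteqP; split => [x -> //|x xt].
  by apply: eq_from_tnth => i; exact: (xt i I).
apply: fin_bigcap_measurable; first exact: finite_finset.
by move=> i _; rewrite -[X in measurable X]setTI; exact: measurable_tnth.
Qed.

Section law_of_binary_vector.
Context {R : realType} {disp : measure_display} {T : measurableType disp}.
Context (P : probability T R) (d : nat) (X : {RV P >-> d.-tuple bool}).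

Definition binary_law (t : d.-tuple bool) : R := fine (P (X @^-1` [set t])%classic).

Let measurable_fiber (t : d.-tuple bool) : measurable (X @^-1` [set t])%classic.
Proof.
exact: (measurable_funPTI X (measurable_tuple_bool1 t)).
Qed.

Lemma binary_law_ge0 t : 0 <= binary_law t.
Proof. exact: fine_ge0. Qed.

(** A function of [X] is the finite sum of its values times the indicators of
    the fibers of [X]. Nonnegativity of [f] allows the exchange of sum and
    integral without any integrability argument. *)
Lemma expectation_binary_law (f : d.-tuple bool -> R) : (forall t, 0 <= f t) ->
  ('E_P[fun w => f (X w)] = (\sum_t binary_law t * f t)%:E)%E.
Proof.
move=> f_ge0; rewrite unlock.
under eq_integral => w _.
  have -> : (f (X w))%:E =
      (\sum_(t <- index_enum (d.-tuple bool))
         ((f t)%:E * (\1_(X @^-1` [set t])%classic w)%:E))%E.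
    rewrite (bigD1 (X w))//= big1 ?adde0.
      by rewrite indicE mem_set// mule1.
    move=> t /eqP tX; rewrite indicE memNset ?mule0// => /=.
    by move=> Xt; exact: tX.
  over.
rewrite ge0_integral_sum//=.
- rewrite -sumEFin; apply: eq_bigr => t _.
  rewrite ge0_integralZl_EFin//; last exact/measurable_EFinP/measurable_indic.
  rewrite integral_indic// setIT mulrC EFinM fineK ?fin_num_measure//.
- move=> t; apply: emeasurable_funM => //.
  exact/measurable_EFinP/measurable_indic.
- by move=> t w _; rewrite mule_ge0 ?lee_fin.
Qed.

Lemma sum_binary_law : \sum_t binary_law t = 1.
Proof.
apply: EFin_inj; rewrite -(expectation_cst P 1) (expectation_binary_law (f := fun=> 1))//.
by under [in RHS]eq_bigr do rewrite mulr1.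
Qed.

Lemma expectation_outer_product (i j : 'I_d) :
  ('E_P[fun w => (binary_col R (X w) *m (binary_col R (X w))^T) i j] =
   (\sum_t binary_law t * ((tnth t i)%:R * (tnth t j)%:R))%:E)%E.
Proof.
rewrite -expectation_binary_law => [|t]; last by rewrite mulr_ge0.
by congr expectation; apply/funext => w; rewrite !mxE big_ord1 !mxE.
Qed.

End law_of_binary_vector.

Section finite_probability.
Context {R : realType} {d : nat} (p : d.-tuple bool -> R).
Hypotheses (p_ge0 : forall t, 0 <= p t) (p_sum1 : \sum_t p t = 1).

(* Finite sums of measures are indexed by initial segments of nat, hence the
   enumeration of the tuples; the default value is never reached. *)
Let atom (k : nat) := nth [tuple of nseq d false] (index_enum (d.-tuple bool)) k.

Let weighted_atom (k : nat) : {measure set (d.-tuple bool) -> \bar R} :=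
  mscale (NngNum (p_ge0 (atom k))) (dirac (atom k)).

Definition finite_measure : set (d.-tuple bool) -> \bar R :=
  msum weighted_atom (size (index_enum (d.-tuple bool))).

HB.instance Definition _ := Measure.on finite_measure.

Let finite_measureE A : finite_measure A = (\sum_t p t * \1_A t)%:E.
Proof.
rewrite /finite_measure /msum /= (big_nth [tuple of nseq d false]) big_mkord.
by rewrite -sumEFin; apply: eq_bigr => k _; rewrite /mscale/= EFinM.
Qed.

Let finite_measure_setT : finite_measure [set: _] = 1%E.
Proof.
by rewrite finite_measureE indicT; under eq_bigr do rewrite mulr1; rewrite p_sum1.
Qed.

HB.instance Definition _ := Measure_isProbability.Build _ _ _
  finite_measure finite_measure_setT.

Lemma exists_finite_probability :
  exists P : probability (d.-tuple bool) R,
    forall A, P A = (\sum_t p t * \1_A t)%:E.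
Proof. by exists finite_measure; exact: finite_measureE. Qed.

End finite_probability.

Lemma big_option (V : nmodType) (I : finType) (F : option I -> V) :
  \sum_o F o = F None + \sum_i F (Some i).
Proof.
rewrite (bigD1 None)//=; congr (_ + _).
rewrite (reindex_omap (I := option I) Some id) => [|[]//].
by apply: eq_bigl => i; rewrite eqxx.
Qed.

(** This removes all measure theory from the problem. For the converse, the
    identity on the space of tuples is a vector with the prescribed law. *)
Lemma bernoulli_compatibleP (R : realType) (d : nat) (B : 'M[R]_d) :
  bernoulli_compatible B <->
  exists p : d.-tuple bool -> R,
    [/\ forall t, 0 <= p t, \sum_t p t = 1
      & forall i j, B i j = \sum_t p t * ((tnth t i)%:R * (tnth t j)%:R)].
Proof.
split=> [[disp [T [P [X EB]]]]|[p [p_ge0 p_sum1 EB]]].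
  exists (binary_law X); split=> [t||i j].
  - exact: binary_law_ge0.
  - exact: sum_binary_law.
  - by apply: EFin_inj; rewrite -EB expectation_outer_product.
have [P PE] := exists_finite_probability p_ge0 p_sum1.
pose X : {mfun (d.-tuple bool) >-> (d.-tuple bool)} :=
  mfun_Sub (mem_set (@measurable_id _ (d.-tuple bool) setT)).
exists _, (d.-tuple bool), P, X => i j.
rewrite EB expectation_outer_product.
congr EFin; apply: eq_bigr => t _; congr (_ * _).
rewrite /binary_law /= PE /= (bigD1 t)//= big1 ?addr0 => [|s st].
  by rewrite indicE mem_set// mulr1.
by rewrite indicE memNset ?mulr0//= => /eqP; rewrite (negPf st).
Qed.

(** To exhibit a law it is easier to index its atoms by an arbitrary finite type
    than to give the weight of every tuple; the atoms [x k] may coincide. *)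
Lemma bernoulli_compatible_mixture (R : realType) (d : nat) (B : 'M[R]_d)
    (K : finType) (w : K -> R) (x : K -> d.-tuple bool) :
  (forall k, 0 <= w k) -> \sum_k w k = 1 ->
  (forall i j, B i j = \sum_k w k * ((tnth (x k) i)%:R * (tnth (x k) j)%:R)) ->
  bernoulli_compatible B.
Proof.
move=> w_ge0 w_sum1 BE; apply/bernoulli_compatibleP.
have partition (f : d.-tuple bool -> R) :
    \sum_t (\sum_(k | x k == t) w k) * f t = \sum_k w k * f (x k).
  rewrite (partition_big x xpredT)//=; apply: eq_bigr => t _.
  by rewrite mulr_suml; apply: eq_bigr => k /eqP ->.
exists (fun t => \sum_(k | x k == t) w k); split=> [t||i j].
- exact: sumr_ge0.
- rewrite -w_sum1; transitivity (\sum_t (\sum_(k | x k == t) w k) * 1).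
    by apply: eq_bigr => t _; rewrite mulr1.
  by rewrite partition; apply: eq_bigr => k _; rewrite mulr1.
- by rewrite BE (partition (fun t => (tnth t i)%:R * (tnth t j)%:R)).
Qed.

(** * Arrow matrices *)

Section arrow_entries.
Context {R : realType} {n : nat} (alpha : 'rV[R]_n) (beta : 'rV[R]_(n + 1)).

Let leaf (i : 'I_n) : 'I_(n + 1) := lshift 1 i.
Let hub : 'I_(n + 1) := rshift n ord0.

Lemma arrow_mx_leaf i j :
  arrow_mx alpha beta (leaf i) (leaf j) = beta 0 (leaf i) *+ (i == j).
Proof. by rewrite /arrow_mx block_mxEul !mxE. Qed.

Lemma arrow_mx_leaf_hub i : arrow_mx alpha beta (leaf i) hub = alpha 0 i.
Proof. by rewrite /arrow_mx block_mxEur !mxE. Qed.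

Lemma arrow_mx_hub_leaf j : arrow_mx alpha beta hub (leaf j) = alpha 0 j.
Proof. by rewrite /arrow_mx block_mxEdl. Qed.

Lemma arrow_mx_hub : arrow_mx alpha beta hub hub = beta 0 hub.
Proof. by rewrite /arrow_mx block_mxEdr mxE. Qed.

End arrow_entries.

Lemma natr_sqr_ge (R : numDomainType) (m : nat) : m%:R <= m%:R ^+ 2 :> R.
Proof. by rewrite -natrX ler_nat -mulnn; case: m => // m; rewrite leq_pmulr. Qed.

(** The inequality of total masses and the bound by the hub come from the same
    device: S^2 - S is a nonnegative variable of mean zero, which absorbs the
    outcomes where two leaves are 1. *)
Lemma arrow_necessary (R : realType) (n : nat) (alpha : 'rV[R]_n)
    (beta : 'rV[R]_(n + 1)) :
  bernoulli_compatible (arrow_mx alpha beta) ->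
  [/\ forall i : 'I_n, 0 <= alpha 0 i <= beta 0 (lshift 1 i),
      \sum_(i < n) alpha 0 i <= beta 0 (rshift n ord0)
    & \sum_(i < n + 1) beta 0 i - \sum_(i < n) alpha 0 i <= 1].
Proof.
move=> /bernoulli_compatibleP[p [p_ge0 p_sum1 pE]].
pose mean (f : (n + 1).-tuple bool -> R) := \sum_t p t * f t.
have mean_ge0 f : (forall t, 0 <= f t) -> 0 <= mean f.
  by move=> f_ge0; apply: sumr_ge0 => t _; rewrite mulr_ge0.
have meanD f g : mean (fun t => f t + g t) = mean f + mean g.
  by rewrite /mean -big_split; apply: eq_bigr => t _; rewrite mulrDr.
have meanN f : mean (fun t => - f t) = - mean f.
  by rewrite /mean -sumrN; apply: eq_bigr => t _; rewrite mulrN.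
have mean_sum (f : 'I_n -> (n + 1).-tuple bool -> R) :
    mean (fun t => \sum_i f i t) = \sum_i mean (f i).
  by rewrite /mean exchange_big; apply: eq_bigr => t _; rewrite mulr_sumr.
have mean1 : mean (fun=> 1) = 1.
  by rewrite -[RHS]p_sum1; apply: eq_bigr => t _; rewrite mulr1.
pose leaf i (t : (n + 1).-tuple bool) : R := (tnth t (lshift 1 i))%:R.
pose hub (t : (n + 1).-tuple bool) : R := (tnth t (rshift n ord0))%:R.
pose count (t : (n + 1).-tuple bool) : R := \sum_i leaf i t.
have countE t : count t = (\sum_(i < n) tnth t (lshift 1 i))%:R.
  by rewrite natr_sum.
have count_sq t : count t <= count t ^+ 2 by rewrite countE natr_sqr_ge.
have hub01 t : hub t = 0 \/ hub t = 1 by rewrite /hub; case: (tnth _ _); [right|left].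
have mean_leafM i j : mean (fun t => leaf i t * leaf j t) =
    beta 0 (lshift 1 i) *+ (i == j).
  by rewrite -(arrow_mx_leaf alpha) pE.
have mean_leaf_hub i : mean (fun t => leaf i t * hub t) = alpha 0 i.
  by rewrite -(arrow_mx_leaf_hub _ beta) pE.
have mean_hub : mean hub = beta 0 (rshift n ord0).
  rewrite -(arrow_mx_hub alpha) pE; apply: eq_bigr => t _.
  by rewrite /hub; case: (tnth _ _); rewrite /= ?mulr1 ?mulr0.
have mean_leaf i : mean (leaf i) = beta 0 (lshift 1 i).
  have := mean_leafM i i; rewrite eqxx mulr1n => <-; apply: eq_bigr => t _.
  by rewrite /leaf; case: (tnth _ _); rewrite /= ?mulr1 ?mulr0.
have mean_count : mean count = \sum_i beta 0 (lshift 1 i).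
  by rewrite mean_sum; apply: eq_bigr => i _; rewrite mean_leaf.
have mean_count_sq : mean (fun t => count t ^+ 2) = mean count.
  rewrite mean_count.
  transitivity (mean (fun t => \sum_i \sum_j leaf i t * leaf j t)).
    by apply: eq_bigr => t _; rewrite expr2 mulr_suml; under eq_bigr do rewrite mulr_sumr.
  rewrite mean_sum; apply: eq_bigr => i _; rewrite mean_sum (bigD1 i)//=.
  rewrite mean_leafM eqxx big1 ?addr0// => j ji.
  by rewrite mean_leafM eq_sym (negPf ji).
have mean_count_hub : mean (fun t => count t * hub t) = \sum_i alpha 0 i.
  transitivity (mean (fun t => \sum_i leaf i t * hub t)).
    by apply: eq_bigr => t _; rewrite mulr_suml.
  by rewrite mean_sum; apply: eq_bigr => i _; exact: mean_leaf_hub.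
split=> [i||].
- apply/andP; split.
    by rewrite -mean_leaf_hub mean_ge0// => t; rewrite mulr_ge0.
  rewrite -subr_ge0 -mean_leaf -mean_leaf_hub -meanN -meanD mean_ge0// => t.
  by case: (hub01 t) => ->; rewrite ?mulr1 ?mulr0 ?subrr ?subr0.
- (* Where the hub is 0 this is S^2 - S, and where it is 1 it is (S - 1)^2. *)
  have : 0 <= mean (fun t => hub t + count t ^+ 2 - count t - count t * hub t).
    by apply: mean_ge0 => t; have := count_sq t; case: (hub01 t) => ->; nra.
  by rewrite !(meanD, meanN) mean_count_sq mean_hub mean_count_hub; lra.
- (* Where the hub is 0 this is (S - 1)^2, and where it is 1 it is S^2 - S. *)
  have : 0 <= mean (fun t => 1 + count t ^+ 2 - count t
                             - (count t + hub t - count t * hub t)).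
    apply: mean_ge0 => t; have := count_sq t; have := sqr_ge0 (count t - 1).
    by case: (hub01 t) => ->; lra.
  rewrite !(meanD, meanN) mean1 mean_count_sq mean_hub mean_count_hub mean_count.
  by rewrite big_split_ord/= big_ord1; lra.
Qed.

(** The atoms are pairs [(o, b)]: [o] is the leaf equal to 1, if there is one,
    and [b] is the value of the hub. No atom has two leaves equal to 1, whence
    the zeros of the matrix. *)
Lemma arrow_sufficient (R : realType) (n : nat) (alpha : 'rV[R]_n)
    (beta : 'rV[R]_(n + 1)) :
  (forall i : 'I_n, 0 <= alpha 0 i <= beta 0 (lshift 1 i)) ->
  \sum_(i < n) alpha 0 i <= beta 0 (rshift n ord0) ->
  \sum_(i < n + 1) beta 0 i - \sum_(i < n) alpha 0 i <= 1 ->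
  bernoulli_compatible (arrow_mx alpha beta).
Proof.
move=> alpha_bounds alpha_sum total.
pose w (k : option 'I_n * bool) : R :=
  match k with
  | (Some i, true) => alpha 0 i
  | (Some i, false) => beta 0 (lshift 1 i) - alpha 0 i
  | (None, true) => beta 0 (rshift n ord0) - \sum_i alpha 0 i
  | (None, false) => 1 - (\sum_i beta 0 i - \sum_i alpha 0 i)
  end.
pose x (k : option 'I_n * bool) : (n + 1).-tuple bool :=
  [tuple match fintype.split l with inl i => k.1 == Some i | inr _ => k.2 end | l < n + 1].
have x_leaf k i : tnth (x k) (lshift 1 i) = (k.1 == Some i).
  by rewrite tnth_mktuple (unsplitK (inl i)).
have x_hub k i : tnth (x k) (rshift n i) = k.2.
  by rewrite tnth_mktuple (unsplitK (inr i)).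
have sumK (F : option 'I_n * bool -> R) : \sum_k F k =
    F (None, true) + F (None, false) + \sum_i (F (Some i, true) + F (Some i, false)).
  transitivity (\sum_o \sum_b F (o, b)).
    by rewrite pair_bigA; apply: eq_bigr => -[].
  rewrite big_option big_bool.
  by congr (_ + _); apply: eq_bigr => i _; rewrite big_bool.
apply: (bernoulli_compatible_mixture (w := w) (x := x)) => [[[i|] []]||i j] /=.
- by have /andP[] := alpha_bounds i.
- by have /andP[_] := alpha_bounds i; rewrite subr_ge0.
- by rewrite subr_ge0.
- by rewrite subr_ge0.
- rewrite sumK; under eq_bigr do rewrite /= addrC subrK.
  by rewrite /= big_split_ord/= big_ord1; lra.
- have sum_pick (F : 'I_n -> R) i0 : \sum_i F i * (Some i == Some i0)%:R = F i0.
    rewrite (bigD1 i0)//= eqxx mulr1 big1 ?addr0// => i1 /negPf i10.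
    by rewrite (inj_eq (@Some_inj _)) i10 mulr0.
  rewrite sumK; case: (split_ordP i) => i0 ->; case: (split_ordP j) => j0 ->.
  + rewrite arrow_mx_leaf !x_leaf/= !mul0r !mulr0 !add0r.
    under eq_bigr do rewrite !x_leaf/= -mulrDl addrC subrK mulrA.
    rewrite (sum_pick (fun i => _)) (inj_eq (@Some_inj _)) mulr_natr.
    by rewrite [j0 == i0]eq_sym; case: eqP => [->|].
  + rewrite !ord1 arrow_mx_leaf_hub !x_leaf/= !mul0r !mulr0 !add0r.
    under eq_bigr do rewrite !x_leaf !x_hub/= mulr0 mulr0 addr0 mulr1.
    by rewrite sum_pick.
  + rewrite !ord1 arrow_mx_hub_leaf !x_leaf/= !mulr0 !add0r.
    under eq_bigr do rewrite !x_leaf !x_hub/= mul0r mulr0 addr0 mul1r.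
    by rewrite sum_pick.
  + rewrite !ord1 arrow_mx_hub !x_hub.
    under eq_bigr do rewrite !x_hub/= !mulr0 !mulr1 addr0.
    by rewrite /= !mulr0 !mulr1 addr0 subrK.
Qed.

Theorem proposition2p1 (R : realType) (n : nat) (hd : (2 <= n + 1)%N)
    (alpha : 'rV[R]_n) (beta : 'rV[R]_(n + 1)) :
  bernoulli_compatible (arrow_mx alpha beta) <->
  [/\ forall i : 'I_n, 0 <= alpha 0 i <= beta 0 (lshift 1 i),
      \sum_(i < n) alpha 0 i <= beta 0 (rshift n ord0)
    & \sum_(i < n + 1) beta 0 i - \sum_(i < n) alpha 0 i <= 1].
Proof.
split; first exact: arrow_necessary.
by case; exact: arrow_sufficient.
Qed.
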